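(* Let $m$ be a positive integer, let $K$ be an integer with $0\le K\le m-1$, and let $a_1,a_2,a_3$ be non-negative integers. Then $$\begin{aligned}S_m(\{a_1,a_2,a_3\},K)={}&\left(\left\lfloor\frac{a_1+a_2+a_3}{m}\right\rfloor-\left\lfloor\frac{a_1+a_2}{m}\right\rfloor-\left\lfloor\frac{a_2+a_3}{m}\right\rfloor-\left\lfloor\frac{a_1+a_3}{m}\right\rfloor\right.\\&\left.\quad+\left\lfloor\frac{a_1}{m}\right\rfloor+\left\lfloor\frac{a_2}{m}\right\rfloor+\left\lfloor\frac{a_3}{m}\right\rfloor\right)(K+1)\\&+\max\bigl(0,\,((a_1+a_2+a_3)\bmod m)+K-m+1\bigr)\\&-\max\bigl(0,\,((a_1+a_2)\bmod m)+K-m+1\bigr)\\&-\max\bigl(0,\,((a_2+a_3)\bmod m)+K-m+1\bigr)\\&-\max\bigl(0,\,((a_1+a_3)\bmod m)+K-m+1\bigr)\\&+\max\bigl(0,\,(a_1\bmod m)+K-m+1\bigr)\\&+\max\bigl(0,\,(a_2\bmod m)+K-m+1\bigr)\\&+\max\bigl(0,\,(a_3\bmod m)+K-m+1\bigr).\end{aligned}$$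
   Context: For a positive integer $m$ and non-negative integers $a_1,a_2,a_3,K$ (the $a_i$ need not be distinct; $\{a_1,a_2,a_3\}$ is just a list of parameters), define $$\begin{aligned}S_m(\{a_1,a_2,a_3\},K)=\sum_{k=0}^K\Bigl(&\left\lfloor\tfrac{a_1+a_2+a_3+k}{m}\right\rfloor-\left\lfloor\tfrac{a_1+a_2+k}{m}\right\rfloor-\left\lfloor\tfrac{a_2+a_3+k}{m}\right\rfloor-\left\lfloor\tfrac{a_1+a_3+k}{m}\right\rfloor\\&+\left\lfloor\tfrac{a_1+k}{m}\right\rfloor+\left\lfloor\tfrac{a_2+k}{m}\right\rfloor+\left\lfloor\tfrac{a_3+k}{m}\right\rfloor-\left\lfloor\tfrac{k}{m}\right\rfloor\Bigr).\end{aligned}$$ For an integer $a$, $(a \bmod m)$ denotes the minimal non-negative representative of the class of $a$ in $\mathbb{Z}/m$, i.e. the integer in $\{0,\dots,m-1\}$ congruent to $a$ modulo $m$. *)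

(* Defs.v *)
From mathcomp Require Import all_boot all_order all_algebra.

Set Implicit Arguments.
Unset Strict Implicit.
Unset Printing Implicit Defensive.

Import Order.TTheory GRing.Theory Num.Theory.
Local Open Scope ring_scope.

(* The arguments are natural numbers, so each floor is a quotient in nat; the
   quotients are cast to int before the signed sum, which avoids truncated
   subtraction. *)
Definition floor_sum (m a1 a2 a3 K : nat) : int :=
  \sum_(0 <= k < K.+1)
    (((a1 + a2 + a3 + k) %/ m)%N%:Z
     - ((a1 + a2 + k) %/ m)%N%:Z
     - ((a2 + a3 + k) %/ m)%N%:Z
     - ((a1 + a3 + k) %/ m)%N%:Z
     + ((a1 + k) %/ m)%N%:Z
     + ((a2 + k) %/ m)%N%:Z
     + ((a3 + k) %/ m)%N%:Z
     - (k %/ m)%N%:Z).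

(* Main.v *)
(* For k < m the floor of (a + k) / m is that of a / m, plus a carry exactly
   when m <= a mod m + k; over an interval of length n <= m the carries add up
   to max(0, a mod m + n - m). *)

Require Import Defs.
From mathcomp Require Import all_boot all_order all_algebra zify ring.

Import Order.TTheory GRing.Theory Num.Theory.
Local Open Scope ring_scope.

(** The sum splits by linearity into eight sums of single floors. Seven have a closed form by
    [sum_divnD_int], with no interaction between the [ai]; the eighth, of [k %/ m], vanishes as
    [k <= K < m]. *)

(* The truncated subtraction plays the role of the maximum with 0. *)
Lemma sum_divnD (m a n : nat) : (0 < m)%N -> (n <= m)%N ->
  (\sum_(0 <= k < n) (a + k) %/ m = a %/ m * n + (a %% m + n - m))%N.
Proof.
move=> m_gt0; have lt_am := ltn_pmod a m_gt0.
elim: n => [|n IHn] le_nm; first by rewrite big_geq //; lia.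
(* The new term adds the carry of [divnD]; the truncated [a %% m + n - m] grows by 1 exactly when
   [m <= a %% m + n]. *)
by rewrite big_nat_recr //= IHn 1?ltnW // divnD // (divn_small le_nm)
  (modn_small le_nm); case: leqP; lia.
Qed.

Lemma sum_divnD_int (m a K : nat) : (K < m)%N ->
  \sum_(0 <= k < K.+1) ((a + k) %/ m)%N%:Z =
    (a %/ m)%N%:Z * (K%:Z + 1)
    + Num.max 0 ((a %% m)%N%:Z + K%:Z - m%:Z + 1).
Proof.
by move=> lt_Km; rewrite -(big_morph Posz PoszD (erefl 0%:Z)) sum_divnD //; lia.
Qed.

Theorem proposition11 (m K a1 a2 a3 : nat) (hm : (0 < m)%N)
    (hK : (K <= m - 1)%N) :
  floor_sum m a1 a2 a3 K =
    (((a1 + a2 + a3) %/ m)%N%:Z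
     - ((a1 + a2) %/ m)%N%:Z
     - ((a2 + a3) %/ m)%N%:Z
     - ((a1 + a3) %/ m)%N%:Z
     + (a1 %/ m)%N%:Z
     + (a2 %/ m)%N%:Z
     + (a3 %/ m)%N%:Z) * (K%:Z + 1)
    + Num.max 0 (((a1 + a2 + a3) %% m)%N%:Z + K%:Z - m%:Z + 1)
    - Num.max 0 (((a1 + a2) %% m)%N%:Z + K%:Z - m%:Z + 1)
    - Num.max 0 (((a2 + a3) %% m)%N%:Z + K%:Z - m%:Z + 1)
    - Num.max 0 (((a1 + a3) %% m)%N%:Z + K%:Z - m%:Z + 1)
    + Num.max 0 ((a1 %% m)%N%:Z + K%:Z - m%:Z + 1)
    + Num.max 0 ((a2 %% m)%N%:Z + K%:Z - m%:Z + 1)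
    + Num.max 0 ((a3 %% m)%N%:Z + K%:Z - m%:Z + 1).
Proof.
have lt_Km : (K < m)%N by lia.
have sum_divn : \sum_(0 <= k < K.+1) (k %/ m)%N%:Z = 0.
  by apply: big1_seq => k; rewrite mem_index_iota => /= lt_kK; rewrite divn_small //; lia.
rewrite /floor_sum !(big_split, sumrN) /= sum_divn !sum_divnD_int // oppr0 addr0.
ring.
Qed.
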